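(* Let $\mathcal{K}$ be the unitary Koopman operator on $L^2(\Omega,\omega)$, let $\{q_n:n\in\mathbb{N}\}$ be an orthonormal basis of $L^2(\Omega,\omega)$, and let $A$ be the associated unitary matrix acting on $l^2(\mathbb{N})$, $A_{ij}=\langle\mathcal{K}q_j,q_i\rangle$. Suppose that $A$ is sparse, meaning that for any $q_n$, $\mathcal{K}q_n$ can be written as a finite linear combination of basis vectors in $\{q_n:n\in\mathbb{N}\}$. Given a weight function $\tau:\mathbb{N}\to\mathbb{R}_{>0}$, there exists a weight function $\tau':\mathbb{N}\to\mathbb{R}_{>0}$ with $\tau'\ge\tau$ such that: (i) the inclusion map $\iota:l^2_{\tau'}(\mathbb{N})\hookrightarrow l^2_\tau(\mathbb{N})$ is nuclear; (ii) if $u\in l^2_{\tau'}(\mathbb{N})$, then $Au\in l^2_\tau(\mathbb{N})$ with $\|Au\|_\tau\le\|u\|_{\tau'}$.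
   Context: Setting: $\Omega\subseteq\mathbb{R}^d$, $F:\Omega\to\Omega$ preserves a Borel measure $\omega$ and is invertible modulo $\omega$-null sets, so the Koopman operator $[\mathcal{K}g](x)=g(F(x))$ is unitary on $L^2(\Omega,\omega)$; the canonical basis of $l^2(\mathbb{N})$ is identified with $\{q_n\}$. For a positive weight function $\tau:\mathbb{N}\to\mathbb{R}_{>0}$, $l^2_\tau(\mathbb{N})=\{(x_j)_{j\in\mathbb{N}}:\sum_{j=1}^\infty|x_j|^2\tau(j)<\infty\}$, a Hilbert space with inner product $\langle u,v\rangle_\tau=\sum_{j=1}^\infty u_j\overline{v_j}\tau(j)$ and norm $\|u\|_\tau=\sqrt{\sum_{j=1}^\infty|u_j|^2\tau(j)}$. The action of $A$ is $(Au)_i=\sum_jA_{ij}u_j$ (the assertion $Au\in l^2_\tau(\mathbb{N})$ includes that these series converge). A map between Hilbert spaces is nuclear if it is trace class, i.e. of the form $u\mapsto\sum_j s_j\langle u,e_j\rangle f_j$ with $\{e_j\}$, $\{f_j\}$ orthonormal, $s_j\ge0$ and $\sum_js_j<\infty$. *)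

(* Defs.v *)
From HB Require Import structures.
From mathcomp Require Import all_boot all_order all_algebra.
From mathcomp Require Import complex.
From mathcomp Require Import all_classical all_reals all_analysis.

Set Implicit Arguments.
Unset Strict Implicit.
Unset Printing Implicit Defensive.

Import Order.TTheory GRing.Theory Num.Theory.
Import numFieldNormedType.Exports.

Local Open Scope classical_set_scope.
Local Open Scope ring_scope.

Section inner_product.
Context {R : realType}.

(* An inner product space over [R[i]] is given here by an ambient vector space
   [V], the set [H] of its elements and a sesquilinear form [dot] on [H], linear
   on the left.  [dot] may be degenerate: in L^2 the elements at distance 0
   are the functions that agree almost everywhere. *)

Definition dot_norm {V : lmodType R[i]} (dot : V -> V -> R[i]) (u : V) : R :=
  Num.sqrt (complex.Re (dot u u)).

Definition orthonormal {V : lmodType R[i]} (H : set V) (dot : V -> V -> R[i])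
    (e : nat -> V) : Prop :=
  (forall n, H (e n)) /\ (forall m n, dot (e m) (e n) = (m == n)%:R).

Definition orthonormal_basis {V : lmodType R[i]} (H : set V)
    (dot : V -> V -> R[i]) (e : nat -> V) : Prop :=
  orthonormal H dot e /\
  forall u, H u -> forall eps : R, 0 < eps ->
    exists (N : nat) (c : nat -> R[i]),
      dot_norm dot (u - \sum_(i < N) c i *: e i) < eps.

Definition nuclear {V1 V2 : lmodType R[i]}
    (H1 : set V1) (dot1 : V1 -> V1 -> R[i])
    (H2 : set V2) (dot2 : V2 -> V2 -> R[i]) (T : V1 -> V2) : Prop :=
  (forall u, H1 u -> H2 (T u)) /\
  exists (s : nat -> R) (e : nat -> V1) (f : nat -> V2),
    [/\ orthonormal H1 dot1 e,
        orthonormal H2 dot2 f,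
        forall j, 0 <= s j,
        cvgn (series s) &
        forall u, H1 u ->
          (fun n => dot_norm dot2
             (T u - \sum_(j < n) ((s j)%:C%C * dot1 u (e j)) *: f j))
          @ \oo --> (0 : R)].

End inner_product.

Section weighted_l2.
Context {R : realType}.
Implicit Types (tau : nat -> R) (u v : nat -> R[i]).

Definition l2_sqnorm tau u : \bar R :=
  (\sum_(0 <= j <oo) (Normc.normc (u j) ^+ 2 * tau j)%:E)%E.

Definition l2 tau : set (nat -> R[i]) := [set u | (l2_sqnorm tau u < +oo)%E].

Definition l2_norm tau u : R := Num.sqrt (fine (l2_sqnorm tau u)).

(* [R[i]^o] gives [R[i]] the topology of its modulus. *)
Definition complex_series (a : nat -> R[i]) : nat -> R[i]^o := series a.

Definition l2_dot tau u v : R[i] :=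
  limn (complex_series (fun j => u j * (v j)^*%C * (tau j)%:C%C)).

Definition mx_act_cvg (A : nat -> nat -> R[i]) u : Prop :=
  forall i, cvgn (complex_series (fun j => A i j * u j)).

Definition mx_act (A : nat -> nat -> R[i]) u : nat -> R[i] :=
  fun i => limn (complex_series (fun j => A i j * u j)).

End weighted_l2.

(* The measurable types of the library are pointed, hence [Omega0].  No case is
   lost: over an empty space L^2 is zero and has no orthonormal sequence. *)
Definition nonempty_subspace {T : topologicalType} (Omega : set T)
  (Omega0 : Omega !=set0) : Type := set_type Omega.

Section nonempty_subspace.
Context {T : topologicalType} {Omega : set T} (Omega0 : Omega !=set0).

HB.instance Definition _ :=
  Topological.copy (nonempty_subspace Omega0) (set_type Omega).
HB.instance Definition _ := isPointed.Build (nonempty_subspace Omega0)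
  (SigSub (mem_set (projT2 (cid Omega0)))).

End nonempty_subspace.

Notation borel_subspace Omega0 :=
  (g_sigma_algebraType (@open (nonempty_subspace Omega0))).

Section koopman.
Context {R : realType} {d : measure_display} {T : measurableType d}.
Variable mu : {measure set T -> \bar R}.
Implicit Types (F : T -> T) (f g : T -> R[i]) (q : nat -> T -> R[i]).

Definition measure_preserving F : Prop :=
  measurable_fun setT F /\
  forall B, measurable B -> pushforward mu F B = mu B.

Definition invertible_mod_null F : Prop :=
  exists G : T -> T, [/\ measurable_fun setT G,
    {ae mu, forall x, G (F x) = x} & {ae mu, forall x, F (G x) = x}].

Definition L2 : set (T -> R[i]) :=
  [set f : T -> R[i] | (@complex.Re R \o f \in Lfun mu 2%:E) /\
                    (@complex.Im R \o f \in Lfun mu 2%:E)].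

Definition L2_dot f g : R[i] :=
  Complex (Rintegral mu setT (fun x => complex.Re (f x * (g x)^*%C)))
          (Rintegral mu setT (fun x => complex.Im (f x * (g x)^*%C))).

Definition koopman F g : T -> R[i] := g \o F.

Definition koopman_matrix F q : nat -> nat -> R[i] :=
  fun i j => L2_dot (koopman F (q j)) (q i).

Definition koopman_sparse F q : Prop :=
  forall n, exists (N : nat) (c : nat -> R[i]),
    {ae mu, forall x, koopman F (q n) x = (\sum_(i < N) c i *: q i) x}.

End koopman.

(* Main.v *)
Require Import Defs.
From mathcomp Require Import all_boot all_order all_algebra.
From mathcomp Require Import complex.
From mathcomp Require Import all_classical all_reals all_analysis.
From mathcomp Require Import measurable_realfun ring lra.
Import Order.TTheory GRing.Theory Num.Theory.
Import numFieldNormedType.Exports.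
Local Open Scope classical_set_scope.
Local Open Scope ring_scope.

(** Sparsity makes every column of [A] finitely supported: the coordinates of
    [K q_j] in the orthonormal family [q] are the coefficients of the finite
    combination that it equals almost everywhere, so [A i j] vanishes for large
    [i] ([koopman_matrix_column_finite]).  Hence each column lies in [l2 tau],
    whatever [tau] is; let [M j] bound its squared norm there.

    Take [tau' j = 4 ^ (j + 1) * (tau j + M j)].  Two series then converge
    geometrically.

    - The inclusion of [l2 tau'] in [l2 tau] is diagonal: it sends the unit
      vector of [l2 tau'] carried by coordinate [j] to
      [sqrt (tau j / tau' j)] times the unit vector of [l2 tau] carried by the
      same coordinate.  These singular values are at most [2 ^ -(j + 1)], so
      their sum is finite ([l2_inclusion_nuclear]).

    - The squared Hilbert-Schmidt norm of [A] as a map from [l2 tau'] to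
      [l2 tau] is at most the sum of the [M j / tau' j], hence at most [1], and
      it dominates the squared operator norm ([mx_act_bounded]).  The
      Cauchy-Schwarz inequality on finite sections of [A] gives both the
      convergence of the series that define [A u] and the norm estimate. *)

(** * Series of complex numbers *)

Section complex_series.
Set Implicit Arguments.
Unset Strict Implicit.
Context {R : realType}.
Implicit Types (a : nat -> R[i]) (z : R[i]).

Lemma sqr_normc_ReIm z :
  Normc.normc z ^+ 2 = complex.Re z ^+ 2 + complex.Im z ^+ 2.
Proof. by case: z => x y /=; rewrite sqr_sqrtr// addr_ge0// sqr_ge0. Qed.

Lemma normc_nneg z : 0 <= Normc.normc z.
Proof. by case: z => x y /=; rewrite sqrtr_ge0. Qed.

Lemma normr_Re_le z : `|complex.Re z| <= Normc.normc z.
Proof.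
rewrite -(@ler_pXn2r _ 2)// ?nnegrE ?normc_nneg// real_normK ?num_real//.
by rewrite sqr_normc_ReIm lerDl sqr_ge0.
Qed.

Lemma normr_Im_le z : `|complex.Im z| <= Normc.normc z.
Proof.
rewrite -(@ler_pXn2r _ 2)// ?nnegrE ?normc_nneg// real_normK ?num_real//.
by rewrite sqr_normc_ReIm lerDr sqr_ge0.
Qed.

Lemma normc_le_ReIm z :
  Normc.normc z <= `|complex.Re z| + `|complex.Im z|.
Proof.
rewrite -(@ler_pXn2r _ 2)// ?nnegrE ?normc_nneg ?addr_ge0//.
rewrite sqr_normc_ReIm sqrrD !real_normK ?num_real//.
by rewrite lerD2r lerDl mulrn_wge0// mulr_ge0.
Qed.

Lemma normc_sum (n : nat) a :
  Normc.normc (\sum_(0 <= j < n) a j) <= \sum_(0 <= j < n) Normc.normc (a j).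
Proof.
elim: n => [|n IH]; first by rewrite !big_geq// Normc.normc0.
rewrite !big_nat_recr//=; apply: le_trans (le_normcD _ _) _.
by rewrite lerD2r.
Qed.

(** Everything about limits in [R[i]] is reduced to real sequences here; a
    positive radius in [R[i]] is a positive real. *)
Lemma cvg_complex (f : nat -> R[i]^o) (l : R[i]^o) :
  (fun n => complex.Re (f n)) @ \oo --> complex.Re l ->
  (fun n => complex.Im (f n)) @ \oo --> complex.Im l ->
  f @ \oo --> l.
Proof.
move=> /cvgrPdist_lt cRe /cvgrPdist_lt cIm; apply/cvgrPdist_lt => e e0.
have [eR eE] : 0 < complex.Re e /\ e = (complex.Re e)%:C%C.
  by move: e0; case: e => x y; rewrite ltcE /= => /andP[/eqP -> ->].
rewrite eE; near=> n.
have -> : `|l - f n| = (Normc.normc (l - f n))%:C%C by [].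
rewrite ltcR (le_lt_trans (normc_le_ReIm _))// [ltRHS]splitr ltrD//.
- rewrite raddfB/=; near: n; apply: cRe; exact: divr_gt0.
- rewrite raddfB/=; near: n; apply: cIm; exact: divr_gt0.
Unshelve. all: by end_near. Qed.

Lemma Re_sum (n : nat) a :
  complex.Re (\sum_(0 <= j < n) a j) = \sum_(0 <= j < n) complex.Re (a j).
Proof. exact: raddf_sum. Qed.

Lemma Im_sum (n : nat) a :
  complex.Im (\sum_(0 <= j < n) a j) = \sum_(0 <= j < n) complex.Im (a j).
Proof. exact: raddf_sum. Qed.

Lemma complex_series_cvg a (l : R[i]) :
  series (fun j => complex.Re (a j)) @ \oo --> complex.Re l ->
  series (fun j => complex.Im (a j)) @ \oo --> complex.Im l ->
  complex_series a @ \oo --> (l : R[i]^o).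
Proof.
move=> cRe cIm; apply: cvg_complex.
- by under eq_fun do rewrite /complex_series /series Re_sum.
- by under eq_fun do rewrite /complex_series /series Im_sum.
Qed.

Lemma complex_series_lim a (l : R[i]) :
  series (fun j => complex.Re (a j)) @ \oo --> complex.Re l ->
  series (fun j => complex.Im (a j)) @ \oo --> complex.Im l ->
  limn (complex_series a) = l.
Proof.
move=> cRe cIm; apply: (@cvg_lim (R[i]^o)); first exact: norm_hausdorff.
exact: complex_series_cvg.
Qed.

(** Absolute convergence, in the form in which it bounds [mx_act]: squared moduli
    of partial sums pass to the limit, being polynomials in the real and
    imaginary parts. *)
Lemma complex_series_abs_cvg a :
  cvgn (series (fun j => Normc.normc (a j))) ->
  cvgn (complex_series a) /\
  (fun n => Normc.normc (\sum_(0 <= j < n) a j) ^+ 2) @ \oo -->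
    Normc.normc (limn (complex_series a) : R[i]) ^+ 2.
Proof.
move=> ca.
have abs (g : R[i] -> R) : (forall z, `|g z| <= Normc.normc z) ->
    cvgn (series (fun j => g (a j))).
  move=> gle; apply: normed_cvg; apply: series_le_cvg ca => n.
  - exact: normr_ge0.
  - exact: normc_nneg.
  - exact: gle.
have cRe := abs _ normr_Re_le; have cIm := abs _ normr_Im_le.
set l : R[i] := Complex (limn (series (fun j => complex.Re (a j))))
                        (limn (series (fun j => complex.Im (a j)))).
have cl : complex_series a @ \oo --> (l : R[i]^o) by exact: complex_series_cvg.
split; first by apply/cvg_ex; exists l.
rewrite (@complex_series_lim a l)// sqr_normc_ReIm.
under eq_fun do rewrite sqr_normc_ReIm Re_sum Im_sum !expr2.
by rewrite !expr2; apply: cvgD; apply: cvgM.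
Qed.

Lemma complex_series_single a (k : nat) :
  (forall j, j != k -> a j = 0) -> limn (complex_series a) = a k.
Proof.
move=> a0; apply: (@cvg_lim (R[i]^o)); first exact: norm_hausdorff.
apply: cvg_near_cst; near=> n.
have kn : (k < n)%N by near: n; exact: nbhs_infty_gt.
rewrite /complex_series /series/= (bigD1_seq k)/= ?mem_index_iota ?iota_uniq//.
by rewrite big1 ?addr0.
Unshelve. all: by end_near. Qed.

End complex_series.

(** * Weighted square-summable sequences *)

Section weighted_l2.
Set Implicit Arguments.
Unset Strict Implicit.
Context {R : realType}.
Implicit Types (tau : nat -> R) (u : nat -> R[i]).

Lemma l2_term_ge0 tau u j : (forall n, 0 < tau n) ->
  0 <= Normc.normc (u j) ^+ 2 * tau j.
Proof. by move=> t0; rewrite mulr_ge0 ?sqr_ge0// ltW. Qed.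

Lemma l2_partial_le tau u (n : nat) : (forall n, 0 < tau n) -> l2 tau u ->
  \sum_(0 <= j < n) Normc.normc (u j) ^+ 2 * tau j <= fine (l2_sqnorm tau u).
Proof.
move=> t0 lu; rewrite -lee_fin fineK.
  rewrite -sumEFin; apply: nneseries_lim_ge => j _ _.
  by rewrite lee_fin l2_term_ge0.
rewrite ge0_fin_numE//; apply: nneseries_ge0 => j _ _.
by rewrite lee_fin l2_term_ge0.
Qed.

(** Reduces membership in [l2] and norm bounds to estimates on finite sums of
    reals; [l2_partial_le] is the converse. *)
Lemma l2_of_partial_le tau u (M : R) : (forall n, 0 < tau n) ->
  (forall n, \sum_(0 <= j < n) Normc.normc (u j) ^+ 2 * tau j <= M) ->
  l2 tau u /\ fine (l2_sqnorm tau u) <= M.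
Proof.
move=> t0 uM.
have le : (l2_sqnorm tau u <= M%:E)%E.
  apply: lime_le.
    by apply: is_cvg_nneseries => j _ _; rewrite lee_fin l2_term_ge0.
  by apply: nearW => n; rewrite sumEFin lee_fin.
have lt : l2 tau u by rewrite /l2/= (le_lt_trans le)// ltry.
split=> //; rewrite -lee_fin fineK// ge0_fin_numE//.
by apply: nneseries_ge0 => j _ _; rewrite lee_fin l2_term_ge0.
Qed.

Lemma l2_series_cvg tau u : (forall n, 0 < tau n) -> l2 tau u ->
  series (fun j => Normc.normc (u j) ^+ 2 * tau j) @ \oo -->
    fine (l2_sqnorm tau u).
Proof.
move=> t0 lu.
have ge0 : (0 <= l2_sqnorm tau u)%E.
  by apply: nneseries_ge0 => j _ _; rewrite lee_fin l2_term_ge0.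
rewrite (_ : series _ = fine \o (fun n =>
  \sum_(0 <= j < n) (Normc.normc (u j) ^+ 2 * tau j)%:E)%E); last first.
  by apply/funext => n; rewrite /= sumEFin.
apply: fine_cvg; rewrite fineK ?ge0_fin_numE//.
by apply: is_cvg_nneseries => j _ _; rewrite lee_fin l2_term_ge0.
Qed.

(** Identifies the norm of the nuclearity condition, the square root of the real
    part of a complex limit, with the one defined by an extended real series. *)
Lemma l2_dot_self tau u : (forall n, 0 < tau n) -> l2 tau u ->
  dot_norm (l2_dot tau) u = l2_norm tau u.
Proof.
move=> t0 lu; rewrite /dot_norm /l2_norm /l2_dot.
have tE j : u j * (u j)^*%C * (tau j)%:C%C =
    (Normc.normc (u j) ^+ 2 * tau j)%:C%C.
  rewrite sqr_normc_ReIm; case: (u j) => x y.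
  by apply/eqP; rewrite eq_complex/=; apply/andP; split; apply/eqP; ring.
under eq_fun do rewrite tE.
rewrite (@complex_series_lim _ _ (fine (l2_sqnorm tau u))%:C%C)//=.
  exact: l2_series_cvg.
have -> : series (fun _ : nat => 0 : R) = (fun=> 0).
  by apply/funext => n; rewrite /series/= big1.
exact: cvg_cst.
Qed.

Lemma l2_norm_tail_cvg tau u : (forall n, 0 < tau n) -> l2 tau u ->
  (fun n => l2_norm tau (fun j => if (j < n)%N then 0 else u j)) @ \oo -->
    (0 : R).
Proof.
move=> t0 lu.
rewrite -[X in _ --> X](@sqrtr0 R).
apply: (@cvg_comp _ _ _ _ Num.sqrt); last exact: sqrt_continuous.
apply: (@fine_cvg _ _ _ _ (fun n =>
  l2_sqnorm tau (fun j => if (j < n)%N then 0 else u j))) => /=.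
have tail n : l2_sqnorm tau (fun j => if (j < n)%N then 0 else u j) =
    (\sum_(n <= j <oo) (Normc.normc (u j) ^+ 2 * tau j)%:E)%E.
  rewrite /l2_sqnorm [RHS]eseries_cond [RHS]eseries_mkcond.
  apply: eq_eseriesr => j _; case: ltnP => //= _.
  by rewrite expr0n/= addr0 sqrtr0 expr0n mul0r.
under eq_fun do rewrite tail.
apply: nneseries_tail_cvg => // j _.
by rewrite lee_fin l2_term_ge0.
Qed.

End weighted_l2.

(** * Nuclearity of the inclusion *)

Section inclusion.
Set Implicit Arguments.
Unset Strict Implicit.
Context {R : realType}.
Implicit Types (tau : nat -> R) (u : nat -> R[i]).

(** The normalisation makes this a unit vector of [l2 tau], not of [l2]. *)
Definition weighted_delta tau (j : nat) : nat -> R[i] :=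
  fun i => if i == j then ((Num.sqrt (tau j))^-1)%:C%C else 0.

Lemma l2_weighted_delta tau j : (forall n, 0 < tau n) ->
  l2 tau (weighted_delta tau j).
Proof.
move=> t0; apply: (proj1 (@l2_of_partial_le _ _ _ 1 t0 _)) => n.
have term i : Normc.normc (weighted_delta tau j i) ^+ 2 * tau i =
    (i == j)%:R.
  rewrite /weighted_delta; case: eqP => [->|_].
    rewrite sqr_normc_ReIm/= expr0n/= addr0 exprVn sqr_sqrtr ?ltW//.
    by rewrite mulVf// gt_eqF.
  by rewrite Normc.normc0 expr0n/= mul0r.
under eq_bigr do rewrite term.
have [jn|nj] := ltnP j n.
  rewrite (bigD1_seq j)/= ?mem_index_iota ?iota_uniq// eqxx big1 ?addr0//.
  by move=> i /negbTE ->.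
rewrite big_nat big1// => i /andP[_ i_n].
by rewrite ltn_eqF// (leq_trans i_n).
Qed.

Lemma l2_dot_weighted_delta tau u j : (forall n, 0 < tau n) ->
  l2_dot tau u (weighted_delta tau j) = u j * (Num.sqrt (tau j))%:C%C.
Proof.
move=> t0; rewrite /l2_dot (@complex_series_single _ _ j) /weighted_delta.
  rewrite eqxx -mulrA; congr (_ * _).
  have -> : (((Num.sqrt (tau j))^-1)%:C)^*%C = ((Num.sqrt (tau j))^-1)%:C%C.
    by apply/eqP; rewrite eq_complex/= oppr0 !eqxx.
  rewrite -rmorphM/= -{2}(@sqr_sqrtr _ (tau j)) ?ltW// expr2 mulrA.
  by rewrite mulVf ?mul1r// gt_eqF// sqrtr_gt0.
by move=> i /negbTE ->; rewrite rmorph0 mulr0 mul0r.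
Qed.

Lemma weighted_delta_orthonormal tau : (forall n, 0 < tau n) ->
  Defs.orthonormal (l2 tau) (l2_dot tau) (weighted_delta tau).
Proof.
move=> t0; split=> [n|m n]; first exact: l2_weighted_delta.
rewrite l2_dot_weighted_delta// /weighted_delta eq_sym; case: eqP => [->|_].
  by rewrite -rmorphM/= mulVf// gt_eqF// sqrtr_gt0.
by rewrite mul0r.
Qed.

(** The inclusion is diagonal in the normalised coordinate vectors, with singular
    values [sqrt (tau j) / sqrt (tau' j)].  The first [n] terms of this
    expansion restore the first [n] coordinates of [u], so the remainder is the
    tail of [u], which tends to [0] in [l2 tau]. *)
Lemma l2_inclusion_nuclear tau tau' : (forall n, 0 < tau n) ->
  (forall n, tau n <= tau' n) ->
  cvgn (series (fun j => Num.sqrt (tau j) / Num.sqrt (tau' j))) ->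
  nuclear (l2 tau') (l2_dot tau') (l2 tau) (l2_dot tau) id.
Proof.
move=> t0 tt' cs.
have t'0 n : 0 < tau' n by exact: lt_le_trans (tt' n).
have incl u : l2 tau' u -> l2 tau u.
  move=> lu; apply: (proj1 (@l2_of_partial_le _ _ _ _ t0 _)) => n.
  apply: le_trans (l2_partial_le n t'0 lu).
  by apply: ler_sum => j _; rewrite ler_wpM2l// sqr_ge0.
split=> //.
exists (fun j => Num.sqrt (tau j) / Num.sqrt (tau' j)),
  (weighted_delta tau'), (weighted_delta tau).
split=> //; try exact: weighted_delta_orthonormal.
move=> u lu.
rewrite (_ : (fun n : nat => _) = (fun n => l2_norm tau
    (fun j => if (j < n)%N then 0 else u j))).
  by apply: l2_norm_tail_cvg => //; exact: incl.
apply/funext => n; set w := u - _.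
have -> : w = fun j => if (j < n)%N then 0 else u j.
  apply/funext => i; rewrite /w.
  rewrite !fctE; set S := (X in _ - X).
  have -> : S = \sum_(j < n) (if i == j :> nat then u i else 0).
    rewrite /S fct_sumE; apply: eq_bigr => j _.
    rewrite l2_dot_weighted_delta// !fctE /weighted_delta.
    case: eqP => [->|_]; last by rewrite scaler0.
    (* The scalar is [s j * (u j * sqrt (tau' j)) / sqrt (tau j) = u j]. *)
    rewrite /GRing.scale/= mulrCA -mulrA -!rmorphM/=.
    by rewrite divfK ?gt_eqF ?sqrtr_gt0// divff ?mulr1// gt_eqF ?sqrtr_gt0.
  rewrite -big_mkcond/=.
  case: (ltnP i n) => [i_n|ni].
    by rewrite (big_pred1 (Ordinal i_n))// subrr.
  rewrite big_pred0 ?subr0// => j.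
  by rewrite gtn_eqF// (leq_trans _ ni).
rewrite l2_dot_self//.
apply: (proj1 (@l2_of_partial_le _ _ _ _ t0 _)) => m.
apply: le_trans (l2_partial_le m t0 (incl _ lu)).
apply: ler_sum => j _; apply: ler_wpM2r; first exact: ltW.
case: ifP => //= _.
by rewrite expr0n/= addr0 sqrtr0 expr0n sqr_ge0.
Qed.

End inclusion.

(** * Matrices with finitely supported columns *)

Section column_finite_matrix.
Context {R : realType}.
Set Implicit Arguments.
Unset Strict Implicit.
Implicit Types (tau : nat -> R) (u : nat -> R[i]) (A : nat -> nat -> R[i]).

Lemma CauchySchwarz_sum (n : nat) (a b : nat -> R) :
  (\sum_(0 <= j < n) a j * b j) ^+ 2 <=
  (\sum_(0 <= j < n) a j ^+ 2) * (\sum_(0 <= j < n) b j ^+ 2).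
Proof.
elim: n => [|n IH]; first by rewrite !big_geq// expr0n/= mul0r.
rewrite !big_nat_recr//=.
have: 0 <= \sum_(0 <= j < n) a j ^+ 2 by rewrite sumr_ge0// => *; exact: sqr_ge0.
have: 0 <= \sum_(0 <= j < n) b j ^+ 2 by rewrite sumr_ge0// => *; exact: sqr_ge0.
move: IH; set S := \sum_(0 <= j < n) _; set P := \sum_(0 <= j < n) _.
set Q := \sum_(0 <= j < n) _; move: (a n) (b n) => x y IH Q0 P0.
(* Given [S ^+ 2 <= P * Q], this is the inequality between the arithmetic and
   geometric means of [P * y ^+ 2] and [Q * x ^+ 2]. *)
suff: 2 * (S * (x * y)) <= P * y ^+ 2 + Q * x ^+ 2 by move: IH; lra.
apply: le_trans (ler_norm _) _.
rewrite -(@ler_pXn2r _ 2)// ?nnegrE ?normr_ge0 ?(addr_ge0 (mulr_ge0 P0 _) (mulr_ge0 Q0 _)) ?sqr_ge0//.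
rewrite real_normK ?num_real//.
have -> : (2 * (S * (x * y))) ^+ 2 = 4 * (S ^+ 2 * (x * y) ^+ 2) by ring.
apply: (@le_trans _ _ (4 * (P * Q * (x * y) ^+ 2))).
  by rewrite ler_pM2l// ler_wpM2r ?sqr_ge0.
rewrite -subr_ge0.
have -> : (P * y ^+ 2 + Q * x ^+ 2) ^+ 2 - 4 * (P * Q * (x * y) ^+ 2) =
  (P * y ^+ 2 - Q * x ^+ 2) ^+ 2 by ring.
exact: sqr_ge0.
Qed.

Definition column_finite A :=
  forall j, exists N, forall i, (N <= i)%N -> A i j = 0.

Definition column_sqnorm_bound tau A (j : nat) (M : R) :=
  forall m, \sum_(0 <= i < m) Normc.normc (A i j) ^+ 2 * tau i <= M.

(** The partial sums are constant once they cover the support of the column. *)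
Lemma column_finite_bound tau A : (forall n, 0 < tau n) -> column_finite A ->
  exists M : nat -> R, forall j, column_sqnorm_bound tau A j (M j).
Proof.
move=> t0 fA.
suff: forall j, exists M, column_sqnorm_bound tau A j M.
  by move=> /choice[M AM]; exists M.
move=> j; have [N AN] := fA j.
exists (\sum_(0 <= i < N) Normc.normc (A i j) ^+ 2 * tau i) => m.
have [mN|/ltnW Nm] := leqP m N.
  rewrite [leRHS](big_cat_nat (n:=m))//= lerDl sumr_ge0// => i _.
  by rewrite mulr_ge0 ?sqr_ge0// ltW.
rewrite (big_cat_nat (n:=N))//= gerDl le_eqVlt; apply/orP; left; apply/eqP.
rewrite big_nat big1// => i /andP[Ni _].
by rewrite AN// Normc.normc0 expr0n/= mul0r.
Qed.

(** The Hilbert-Schmidt bound.  With [c i j = |A i j| / sqrt (tau' j)] and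
    [v j = |u j| * sqrt (tau' j)] one has [|A i j * u j| = c i j * v j], where
    the squares of the [v j] sum to at most [S], the squared norm of [u], and
    the [c i j ^+ 2 * tau i] sum to at most [1] over all [i] and [j].
    Cauchy-Schwarz in [j] then bounds every finite section of [A u] by [S],
    and the bound survives the limits, first in [j] and then in [i]. *)
Lemma mx_act_bounded tau tau' A u (M : nat -> R) :
  (forall n, 0 < tau n) -> (forall n, 0 < tau' n) ->
  (forall j, column_sqnorm_bound tau A j (M j)) ->
  (forall n, \sum_(0 <= j < n) M j / tau' j <= 1) ->
  l2 tau' u ->
  [/\ mx_act_cvg A u, l2 tau (mx_act A u) &
      l2_norm tau (mx_act A u) <= l2_norm tau' u].
Proof.
move=> t0 t'0 AM M1 lu; set S := fine (l2_sqnorm tau' u).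
have S0 : 0 <= S.
  by apply: le_trans (l2_partial_le 0 t'0 lu); rewrite big_geq.
pose c i j := Normc.normc (A i j) / Num.sqrt (tau' j).
pose v j := Normc.normc (u j) * Num.sqrt (tau' j).
have cv i j : Normc.normc (A i j * u j) = c i j * v j.
  by rewrite Normc.normcM /c /v mulrACA mulVf ?mulr1 ?gt_eqF ?sqrtr_gt0.
have c0 i j : 0 <= c i j by rewrite divr_ge0 ?normc_nneg ?sqrtr_ge0.
have v0 j : 0 <= v j by rewrite mulr_ge0 ?normc_nneg ?sqrtr_ge0.
have sqv n : \sum_(0 <= j < n) v j ^+ 2 <= S.
  apply: le_trans (l2_partial_le n t'0 lu); apply: ler_sum => j _.
  by rewrite exprMn sqr_sqrtr// ltW.
have sqc m n : \sum_(0 <= i < m) (\sum_(0 <= j < n) c i j ^+ 2) * tau i <= 1.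
  apply: le_trans (M1 n).
  under eq_bigr do rewrite mulr_suml.
  rewrite exchange_big/=; apply: ler_sum => j _.
  have -> : \sum_(0 <= i < m) c i j ^+ 2 * tau i =
      (\sum_(0 <= i < m) Normc.normc (A i j) ^+ 2 * tau i) / tau' j.
    rewrite mulr_suml; apply: eq_bigr => i _.
    by rewrite /c expr_div_n sqr_sqrtr ?ltW// mulrAC.
  by rewrite ler_pM2r ?invr_gt0//; exact: AM.
have partial i n : (\sum_(0 <= j < n) c i j * v j) ^+ 2 <=
    (\sum_(0 <= j < n) c i j ^+ 2) * S.
  apply: le_trans (CauchySchwarz_sum _ _ _) _; rewrite ler_wpM2l//.
  by rewrite sumr_ge0// => j _; exact: sqr_ge0.
have abs i : cvgn (series (fun j => Normc.normc (A i j * u j))).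
  apply: nondecreasing_is_cvgn.
    by apply: nondecreasing_series => n _ _; exact: normc_nneg.
  exists (1 + S / tau i) => _ [n _ <-]; rewrite /series/=.
  under eq_bigr do rewrite cv.
  have ci : \sum_(0 <= j < n) c i j ^+ 2 <= (tau i)^-1.
    rewrite -[leRHS]mul1r ler_pdivlMr//; apply: le_trans (sqc i.+1 n).
    rewrite big_nat_recr//= lerDr sumr_ge0// => k _.
    by rewrite mulr_ge0 ?(ltW (t0 _))// sumr_ge0// => j _; exact: sqr_ge0.
  have : (\sum_(0 <= j < n) c i j * v j) ^+ 2 <= S / tau i.
    apply: le_trans (partial i n) _.
    by rewrite mulrC ler_wpM2l.
  (* [x ^+ 2 <= y] gives [x <= 1 + y], as [x <= 1 + x ^+ 2]. *)
  set x := \sum_(0 <= j < n) _; move: (S / tau i) => y; nra.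
have actE i := complex_series_abs_cvg (abs i).
have bound m : \sum_(0 <= i < m) Normc.normc (mx_act A u i) ^+ 2 * tau i <= S.
  have cvm : (fun n => \sum_(0 <= i < m)
      Normc.normc (\sum_(0 <= j < n) A i j * u j) ^+ 2 * tau i) @ \oo -->
      \sum_(0 <= i < m) Normc.normc (mx_act A u i) ^+ 2 * tau i.
    apply: cvg_big => [|i _]; first exact: add_continuous.
    by apply: cvgM; [exact: (actE i).2|exact: cvg_cst].
  rewrite -(cvg_lim (@Rhausdorff R) cvm); apply: limr_le.
    by apply/cvg_ex; eexists; exact: cvm.
  apply: nearW => n.
  apply: (@le_trans _ _ (\sum_(0 <= i < m)
      ((\sum_(0 <= j < n) c i j ^+ 2) * tau i) * S)).
    apply: ler_sum => i _; rewrite [leRHS]mulrAC.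
    apply: ler_wpM2r; first exact: ltW.
    apply: le_trans (partial i n).
    rewrite ler_pXn2r ?nnegrE ?normc_nneg//.
      by under [leRHS]eq_bigr do rewrite -cv; exact: normc_sum.
    by rewrite sumr_ge0// => j _; rewrite mulr_ge0.
  by rewrite -mulr_suml -[leRHS]mul1r ler_wpM2r.
have [lA nA] := l2_of_partial_le t0 bound.
split=> //; first by move=> i; exact: (actE i).1.
by rewrite /l2_norm ler_wsqrtr.
Qed.

End column_finite_matrix.

(** * Columns of the Koopman matrix *)

Section koopman_columns.
Context {R : realType} {d : measure_display} {T : measurableType d}.
Variable mu : {measure set T -> \bar R}.
Set Implicit Arguments.
Unset Strict Implicit.
Implicit Types (F : T -> T) (f g : T -> R[i]) (q : nat -> T -> R[i]).

Let ReC f : T -> R := @complex.Re R \o f.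
Let ImC f : T -> R := @complex.Im R \o f.

Definition complex_measurable f : Prop :=
  measurable_fun setT (ReC f) /\ measurable_fun setT (ImC f).

Lemma L2_measurable f : L2 mu f -> complex_measurable f.
Proof.
by move=> [/sub_Lfun_mfun + /sub_Lfun_mfun]; rewrite !inE.
Qed.

Let Lfun_comb (a : R) (h k : T -> R) :
  h \in Lfun mu 2%:E -> k \in Lfun mu 2%:E -> a *: h + k \in Lfun mu 2%:E.
Proof.
have p1 : (1 <= 2%:E :> \bar R)%E by rewrite lee_fin ler1n.
exact: (Lfun_submod_closed mu p1).2.
Qed.

Lemma L2_0 : L2 mu 0.
Proof.
have p1 : (1 <= 2%:E :> \bar R)%E by rewrite lee_fin ler1n.
by split; exact: (Lfun_submod_closed mu p1).1.
Qed.

Lemma L2_comb (c : R[i]) f g : L2 mu f -> L2 mu g -> L2 mu (c *: f + g).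
Proof.
move=> [fR fI] [gR gI]; split.
- rewrite (_ : _ \o _ =
      complex.Re c *: ReC f + (- complex.Im c *: ImC f + ReC g)).
    by do 2 apply: Lfun_comb => //.
  apply/funext => x; rewrite /ReC /ImC !fctE/= /GRing.scale/=.
  by case: c (f x) (g x) => [a b] [x1 y1] [x2 y2] /=; ring.
- rewrite (_ : _ \o _ =
      complex.Re c *: ImC f + (complex.Im c *: ReC f + ImC g)).
    by do 2 apply: Lfun_comb => //.
  apply/funext => x; rewrite /ReC /ImC !fctE/= /GRing.scale/=.
  by case: c (f x) (g x) => [a b] [x1 y1] [x2 y2] /=; ring.
Qed.

Lemma L2_sum (N : nat) (c : nat -> R[i]) q : (forall n, L2 mu (q n)) ->
  L2 mu (\sum_(i < N) c i *: q i).
Proof.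
move=> qL; elim: N => [|N IH]; first by rewrite big_ord0; exact: L2_0.
by rewrite big_ord_recr/= addrC; exact: L2_comb.
Qed.

Lemma Re_mul_conj (a b : R[i]) : complex.Re (a * b^*%C) =
  complex.Re a * complex.Re b + complex.Im a * complex.Im b.
Proof. by case: a b => [a1 a2] [b1 b2] /=; ring. Qed.

Lemma Im_mul_conj (a b : R[i]) : complex.Im (a * b^*%C) =
  complex.Im a * complex.Re b - complex.Re a * complex.Im b.
Proof. by case: a b => [a1 a2] [b1 b2] /=; ring. Qed.

(** The case [p = q = 2] of Hoelder's inequality, which makes the integrals in
    [L2_dot] additive; without integrability they need not be. *)
Lemma L2_mul_integrable f g : L2 mu f -> L2 mu g ->
  mu.-integrable setT (EFin \o (fun x => complex.Re (f x * (g x)^*%C))) /\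
  mu.-integrable setT (EFin \o (fun x => complex.Im (f x * (g x)^*%C))).
Proof.
move=> [fR fI] [gR gI].
have prod (h k : T -> R) : h \in Lfun mu 2%:E -> k \in Lfun mu 2%:E ->
  mu.-integrable setT (EFin \o (h \* k)).
  by move=> hL kL; apply/Lfun1_integrable; exact: Lfun2_mul_Lfun1.
split.
- under eq_fun do rewrite Re_mul_conj.
  exact: (@integrableD _ _ _ mu setT measurableT _ _ (prod _ _ fR gR) (prod _ _ fI gI)).
- under eq_fun do rewrite Im_mul_conj.
  exact: (@integrableB _ _ _ mu setT measurableT _ _ (prod _ _ fI gR) (prod _ _ fR gI)).
Qed.

Lemma L2_dot_comb (c : R[i]) f g h : L2 mu f -> L2 mu g -> L2 mu h ->
  L2_dot mu (c *: f + g) h = c * L2_dot mu f h + L2_dot mu g h.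
Proof.
move=> fL gL hL.
have [fhR fhI] := L2_mul_integrable fL hL.
have [ghR ghI] := L2_mul_integrable gL hL.
rewrite /L2_dot; case: c => a b.
apply/eqP; rewrite eq_complex/=; apply/andP; split; apply/eqP.
- have afR := integrableZl measurableT a fhR.
  have bfI := integrableZl measurableT b fhI.
  rewrite -!RintegralZl// -RintegralB// -RintegralD//; last first.
    exact: (@integrableB _ _ _ mu setT measurableT _ _ afR bfI).
  apply: eq_Rintegral => x _; rewrite !fctE /GRing.scale/=.
  by case: (f x) (g x) (h x) => [f1 f2] [g1 g2] [h1 h2] /=; ring.
- have afI := integrableZl measurableT a fhI.
  have bfR := integrableZl measurableT b fhR.
  rewrite -!RintegralZl// -RintegralD// -RintegralD//; last first.
    exact: (@integrableD _ _ _ mu setT measurableT _ _ afI bfR).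
  apply: eq_Rintegral => x _; rewrite !fctE /GRing.scale/=.
  by case: (f x) (g x) (h x) => [f1 f2] [g1 g2] [h1 h2] /=; ring.
Qed.

Lemma L2_dot_ae_eq f g h :
  complex_measurable f -> complex_measurable g -> complex_measurable h ->
  {ae mu, forall x, f x = g x} -> L2_dot mu f h = L2_dot mu g h.
Proof.
move=> [fR fI] [gR gI] [hR hI] fg; rewrite /L2_dot.
congr Complex; congr fine; apply: ae_eq_integral => //.
all: try by apply: filterS fg => x fgx _; rewrite fgx.
all: apply/measurable_EFinP.
all: under eq_fun do rewrite ?Re_mul_conj ?Im_mul_conj.
all: first [apply: measurable_funB|apply: measurable_funD];
  exact: measurable_funM.
Qed.

(** [K q_j] may be replaced by the finite combination that it equals almost
    everywhere, all of whose terms have an index below [i] and so are orthogonal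
    to [q i] as soon as [N <= i]. *)
Lemma koopman_matrix_column_finite F q : measurable_fun setT F ->
  Defs.orthonormal (L2 mu) (L2_dot mu) q -> koopman_sparse mu F q ->
  column_finite (koopman_matrix mu F q).
Proof.
move=> mF [qL qq] spF j; have [N [c Fq]] := spF j.
exists N => i Ni; rewrite /koopman_matrix.
rewrite (L2_dot_ae_eq _ _ _ Fq).
- elim: N Ni {Fq} => [|N IH] Ni.
    rewrite big_ord0 /L2_dot.
    have z (k : R[i] -> R) : k 0 = 0 ->
        Rintegral mu setT (fun x => k ((0 : T -> R[i]) x * (q i x)^*%C)) = 0.
      move=> k0; rewrite (@eq_Rintegral _ _ _ mu setT (cst 0)).
        by rewrite Rintegral_cst// mul0r.
      by move=> x _; rewrite fctE mul0r k0.
    by rewrite !z.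
  rewrite big_ord_recr/= addrC L2_dot_comb//; last exact: L2_sum.
  by rewrite IH ?(ltnW Ni)// qq ltn_eqF// mulr0 addr0.
- have [qR qI] := L2_measurable (qL j).
  by split; [exact: (measurableT_comp qR)|exact: (measurableT_comp qI)].
- exact/L2_measurable/L2_sum.
- exact/L2_measurable.
Qed.

End koopman_columns.

(** * The dominating weight *)

Section dominating_weight.
Context {R : realType}.
Set Implicit Arguments.
Unset Strict Implicit.

Lemma sum_half_powers (n : nat) :
  \sum_(0 <= j < n) (2^-1 : R) ^+ j.+1 = 1 - 2^-1 ^+ n.
Proof.
elim: n => [|n IH]; first by rewrite big_geq// expr0 subrr.
by rewrite big_nat_recr//= IH exprS; field.
Qed.

(** The factor [4 ^ (j + 1)], a square, brings [sqrt (tau j) / sqrt (tau' j)]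
    down to at most [2 ^ -(j + 1)], hence makes these ratios summable. *)
Lemma dominating_weight (tau M : nat -> R) :
  (forall n, 0 < tau n) -> (forall n, 0 <= M n) ->
  exists tau' : nat -> R,
    [/\ forall n, 0 < tau' n,
        forall n, tau n <= tau' n,
        cvgn (series (fun j => Num.sqrt (tau j) / Num.sqrt (tau' j))) &
        forall n, \sum_(0 <= j < n) M j / tau' j <= 1].
Proof.
move=> t0 M0; pose tau' j := (2 ^+ j.+1) ^+ 2 * (tau j + M j).
have p0 j : 0 < tau j + M j by rewrite ltr_pwDl.
have t'0 j : 0 < tau' j by rewrite mulr_gt0// exprn_gt0// exprn_gt0.
have pow1 j : 1 <= (2 : R) ^+ j.+1 by rewrite exprn_ege1// ler1n.
exists tau'; split=> //.
- move=> j; apply: (@le_trans _ _ (tau j + M j)); first by rewrite lerDl.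
  by rewrite ler_peMl ?(ltW (p0 j))// exprn_ege1.
- apply: (@series_le_cvg _ _ (geometric 2^-1 2^-1)).
  + by move=> j; rewrite divr_ge0 ?sqrtr_ge0.
  + by move=> j; rewrite /= mulr_ge0 ?exprn_ge0 ?invr_ge0.
  + move=> j; rewrite /= -exprS exprVn /tau' sqrtrM ?sqr_ge0//.
    rewrite sqrtr_sqr ger0_norm ?exprn_ge0// invfM mulrCA ler_piMr//.
    by rewrite ler_pdivrMr ?sqrtr_gt0// mul1r ler_wsqrtr// lerDl.
  + by apply: is_cvg_geometric_series; rewrite ger0_norm// invf_lt1 ?ltr1n.
- move=> n; apply: (@le_trans _ _ (\sum_(0 <= j < n) 2^-1 ^+ j.+1)).
    apply: ler_sum => j _; rewrite ler_pdivrMr// /tau' expr2 exprVn !mulrA.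
    rewrite mulVf ?mul1r ?expf_neq0 ?pnatr_eq0//.
    apply: (@le_trans _ _ (tau j + M j)); first by rewrite lerDr ltW.
    by rewrite ler_peMl// ltW.
  by rewrite sum_half_powers gerBl exprn_ge0// invr_ge0.
Qed.

End dominating_weight.

Theorem lemma6p1 (R : realType) (d : nat)
    (Omega : set 'rV[R]_d) (Omega0 : Omega !=set0)
    (omega : {measure set (borel_subspace Omega0) -> \bar R})
    (F : borel_subspace Omega0 -> borel_subspace Omega0)
    (F_preserving : measure_preserving omega F)
    (F_invertible : invertible_mod_null omega F)
    (q : nat -> borel_subspace Omega0 -> R[i])
    (q_basis : orthonormal_basis (L2 omega) (L2_dot omega) q)
    (A_sparse : koopman_sparse omega F q)
    (tau : nat -> R) (tau_gt0 : forall n, 0 < tau n) :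
  let A := koopman_matrix omega F q in
  exists tau' : nat -> R,
    [/\ forall n, 0 < tau' n,
        forall n, tau n <= tau' n,
        nuclear (l2 tau') (l2_dot tau') (l2 tau) (l2_dot tau) id &
        forall u, l2 tau' u ->
          [/\ mx_act_cvg A u,
              l2 tau (mx_act A u) &
              l2_norm tau (mx_act A u) <= l2_norm tau' u]].
Proof.
move=> A.
have finA : column_finite A.
  exact: koopman_matrix_column_finite F_preserving.1 q_basis.1 A_sparse.
have [M AM] := column_finite_bound tau_gt0 finA.
have M0 j : 0 <= M j by have := AM j 0%N; rewrite big_geq.
have [tau' [tau'_gt0 le_tau nuc M1]] := dominating_weight tau_gt0 M0.
exists tau'; split=> //; first exact: l2_inclusion_nuclear.
move=> u lu; exact: mx_act_bounded AM M1 lu.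
Qed.
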